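(* Let $m\ge 3$, $n\ge 1$ and $k\ge 1$ be integers, and let $G=C_m\Box P_n$. The following statements are equivalent: (1) $G$ admits an efficient dominating set; (2) there exists a $[k]$-Roman dominating function $f:V(G)\to\{0,1,\dots,k+1\}$ such that $\sum_{u\in N[v]} f(u)=k+1$ for every $v\in V(G)$; (3) $G$ is either $C_m\Box P_1$ with $m\equiv 0 \pmod 3$, or $C_m\Box P_2$ with $m\equiv 0\pmod 4$.
   Context: For a graph $G$ and $v\in V(G)$, $N(v)$ is the open neighborhood and $N[v]=N(v)\cup\{v\}$ the closed neighborhood. For an integer $k\ge1$, a function $f:V(G)\to\{0,1,\dots,k+1\}$ is a $[k]$-Roman dominating function ($[k]$-RDF) if for every vertex $v$ with $f(v)<k$ we have $f(N[v])\ge k+|AN(v)|$, where $f(S)=\sum_{u\in S}f(u)$ and $AN(v)=\{u\in N(v): f(u)>0\}$. A set $D\subseteq V(G)$ is an efficient dominating set if every vertex $v\in V(G)$ lies in $N[u]$ for exactly one $u\in D$. $P_n$ is the path on vertices $\{0,\dots,n-1\}$, $C_m$ the cycle on $\{0,\dots,m-1\}$ (indices mod $m$), and $C_m\Box P_n$ is their Cartesian product: vertex set $V(C_m)\times V(P_n)$, with $(i,j)$ adjacent to $(i',j')$ iff either $i=i'$ and $jj'\in E(P_n)$, or $j=j'$ and $ii'\in E(C_m)$. *)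

(* Defs.v *)
(* A graph is an adjacency relation [e : rel T] on a
   [T : finType]; the graphs used below are symmetric and irreflexive, see
   [cart_prod_cycle_path_sym] and [cart_prod_cycle_path_irrefl]. *)
From mathcomp Require Import all_boot.

Set Implicit Arguments.
Unset Strict Implicit.
Unset Printing Implicit Defensive.

Section Domination.

Variables (T : finType) (e : rel T).

Definition open_nbhd (v : T) : {set T} := [set u | e v u].

Definition closed_nbhd (v : T) : {set T} := v |: open_nbhd v.

Definition efficient_dominating_set (D : {set T}) : Prop :=
  forall v : T, exists! u : T, u \in D /\ v \in closed_nbhd u.

Variable k : nat.

(* The values 0, ..., k + 1 are the elements of 'I_k.+2. *)
Implicit Type f : {ffun T -> 'I_k.+2}.

Definition active_nbhd f (v : T) : {set T} := [set u in open_nbhd v | 0 < f u].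

Definition roman_dominating f : Prop :=
  forall v : T, f v < k ->
    k + #|active_nbhd f v| <= \sum_(u in closed_nbhd v) f u.

End Domination.

Definition path_graph (n : nat) : rel 'I_n :=
  fun i j => (j == i.+1 :> nat) || (i == j.+1 :> nat).

(* A simple graph only for m >= 3 (or m = 0): there is a loop when m = 1, and
   m = 2 gives a single edge. *)
Definition cycle_graph (m : nat) : rel 'I_m :=
  fun i j => (j == i.+1 %% m :> nat) || (i == j.+1 %% m :> nat).

Definition cart_prod (T U : finType) (e : rel T) (d : rel U) : rel (T * U) :=
  fun x y => ((x.1 == y.1) && d x.2 y.2) || ((x.2 == y.2) && e x.1 y.1).

Lemma path_graph_sym n : symmetric (@path_graph n).
Proof. by move=> i j; rewrite /path_graph orbC. Qed.

Lemma path_graph_irrefl n : irreflexive (@path_graph n).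
Proof. by move=> i; rewrite /path_graph orbb -[X in X == _]addn0 -addn1 eqn_add2l. Qed.

Lemma cycle_graph_sym m : symmetric (@cycle_graph m).
Proof. by move=> i j; rewrite /cycle_graph orbC. Qed.

Lemma cycle_graph_irrefl m : 3 <= m -> irreflexive (@cycle_graph m).
Proof.
move=> m3 i; rewrite /cycle_graph orbb -{1}(modn_small (ltn_ord i)).
rewrite -[X in X == _ %[mod m]]addn0 -addn1 eqn_modDl.
by rewrite mod0n modn_small // (leq_trans _ m3).
Qed.

Lemma cart_prod_cycle_path_sym m n :
  symmetric (cart_prod (@cycle_graph m) (@path_graph n)).
Proof.
move=> x y; rewrite /cart_prod cycle_graph_sym path_graph_sym.
by rewrite (eq_sym x.1) (eq_sym x.2).
Qed.

Lemma cart_prod_cycle_path_irrefl m n :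
  3 <= m -> irreflexive (cart_prod (@cycle_graph m) (@path_graph n)).
Proof.
by move=> m3 x; rewrite /cart_prod cycle_graph_irrefl // path_graph_irrefl !andbF.
Qed.

(* Main.v *)
(* Let f be as in (2).  If 0 < f v <= k then, v having degree at least 2, some
   neighbour x of v has value 0: otherwise f v < k and v has two active
   neighbours.  But x has at most one active neighbour, so v is the only one and
   the sum over N[x] is f v < k + 1.  So f only takes the values 0 and k + 1, and
   f <-> [f = k + 1] exchanges (2) and (1).
   For (1) -> (3), an efficient dominating set D meets the boundary row 0, say at
   (i, 0).  If n >= 2, then D contains (i + 2, 1) and (i - 2, 1), which is
   impossible for n >= 3 and makes row 0 repeat with step exactly 4 for n = 2;
   for n = 1 the step is 3. *)
Require Import Defs.
From mathcomp Require Import all_boot.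
From mathcomp Require Import zify.

Set Implicit Arguments.
Unset Strict Implicit.
Unset Printing Implicit Defensive.

(** * Efficient and perfect [k]-Roman domination in a general graph *)

Section DominationCounting.

Variables (T : finType) (e : rel T).
Hypothesis e_sym : symmetric e.

Lemma closed_nbhd_sym u v : (u \in closed_nbhd e v) = (v \in closed_nbhd e u).
Proof. by rewrite !inE eq_sym e_sym. Qed.

Lemma efficient_sumP (D : {set T}) :
  efficient_dominating_set e D <->
  forall v, \sum_(u in closed_nbhd e v) (u \in D) = 1.
Proof.
have sumE v : \sum_(u in closed_nbhd e v) (u \in D) = #|D :&: closed_nbhd e v|.
  rewrite -sum1_card big_mkcond [RHS]big_mkcond; apply: eq_bigr => u _.
  by rewrite in_setI andbC; case: (u \in closed_nbhd e v); case: (u \in D).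
split=> effD v; last first.
  move/eqP: (effD v); rewrite sumE => /cards1P[u Du].
  have inDE w : (w \in D) && (v \in closed_nbhd e w) = (w == u).
    by rewrite closed_nbhd_sym -in_setI Du in_set1.
  exists u; split; first by apply/andP; rewrite inDE.
  by move=> w /andP; rewrite inDE => /eqP.
have [u [/andP uD uniq_u]] := effD v.
rewrite sumE; apply/eqP/cards1P; exists u.
apply/setP => w; rewrite in_setI in_set1 closed_nbhd_sym.
by apply/idP/eqP => [/andP /uniq_u|->].
Qed.

Variable k : nat.

Lemma roman_of_efficient (D : {set T}) :
  efficient_dominating_set e D ->
  exists f : {ffun T -> 'I_k.+2}, roman_dominating e f /\
    forall v, \sum_(u in closed_nbhd e v) f u = k + 1.
Proof.
move=> /efficient_sumP effD.
pose f := [ffun u => if u \in D then ord_max else ord0 : 'I_k.+2].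
have fE u : f u = k.+1 * (u \in D) :> nat.
  by rewrite ffunE; case: (u \in D); rewrite ?muln1 ?muln0.
have sumf v : \sum_(u in closed_nbhd e v) f u = k + 1.
  by under eq_bigr do rewrite fE; rewrite -big_distrr /= effD muln1 addn1.
(* As every closed sum is k + 1, only [#|active_nbhd e f v| <= 1] remains, and active neighbours lie
   in D and in N[v]. *)
exists f; split=> // v _; rewrite sumf leq_add2l -(effD v).
rewrite -sum1_card big_mkcond [leqRHS]big_mkcond; apply: leq_sum => u _.
by rewrite !inE fE; case: (u \in D); case: (e v u); rewrite ?muln0 ?orbT.
Qed.

Hypothesis e_irr : irreflexive e.
Hypothesis deg2 : forall v, 1 < #|open_nbhd e v|.
Hypothesis k_gt0 : 0 < k.

Lemma sum_closed_nbhd (F : T -> nat) v :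
  \sum_(u in closed_nbhd e v) F u = F v + \sum_(u in open_nbhd e v) F u.
Proof. by rewrite big_setU1 // inE e_irr. Qed.

Lemma perfect_roman_values (f : {ffun T -> 'I_k.+2}) :
  roman_dominating e f ->
  (forall v, \sum_(u in closed_nbhd e v) f u = k + 1) ->
  forall v, f v = k.+1 * (f v == ord_max) :> nat.
Proof.
move=> romf sumf v; case: eqP => [->|/eqP fv_max]; first by rewrite muln1.
rewrite muln0; apply/eqP; rewrite -leqn0 leqNgt; apply/negP => fv_gt0.
have fv_le : f v <= k.
  by move: fv_max (ltn_ord (f v)); rewrite -val_eqE /=; lia.
have [/forall_inP act|] := boolP [forall u in open_nbhd e v, 0 < f u].
  have actE : active_nbhd e f v = open_nbhd e v.
    by apply/setP => u; rewrite inE andb_idr // => /act.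
  (* At least two active neighbours leave [f v < k], so the Roman condition applies and allows only
     one. *)
  have := sumf v; rewrite sum_closed_nbhd => sumv.
  have : #|open_nbhd e v| <= \sum_(u in open_nbhd e v) f u.
    by rewrite -sum1_card; apply: leq_sum => u /act.
  have := romf v; rewrite actE sumf; have := deg2 v; lia.
rewrite negb_forall_in => /exists_inP[x]; rewrite inE -leqNgt leqn0 => vx fx0.
have fx : f x < k by rewrite (eqP fx0).
have xv : v \in open_nbhd e x by rewrite inE e_sym.
have vact : v \in active_nbhd e f x by rewrite inE xv.
have := romf x fx; rewrite sumf leq_add2l => act1.
have /cards1P[w actE] : #|active_nbhd e f x| == 1.
  by rewrite eqn_leq act1; apply/card_gt0P; exists v.
move: vact; rewrite actE in_set1 => /eqP vw.
have := sumf x; rewrite sum_closed_nbhd (eqP fx0) (bigD1 v) //= big1; first lia.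
move=> u /andP[xu uv]; apply/eqP; rewrite -leqn0 leqNgt; apply/negP => fu.
have : u \in active_nbhd e f x by rewrite inE xu.
by rewrite actE in_set1 -vw (negbTE uv).
Qed.

Lemma efficient_of_roman (f : {ffun T -> 'I_k.+2}) :
  roman_dominating e f ->
  (forall v, \sum_(u in closed_nbhd e v) f u = k + 1) ->
  efficient_dominating_set e [set v | f v == ord_max].
Proof.
move=> romf sumf; apply/efficient_sumP => v.
apply/eqP; rewrite -(eqn_pmul2l (ltn0Sn k)); apply/eqP.
rewrite muln1 big_distrr /= -[RHS]addn1 -(sumf v).
by apply: eq_bigr => u _; rewrite inE -perfect_roman_values.
Qed.

End DominationCounting.

(* A function on the cylinder, unrolled to the strip [nat * nat]: [m]-periodic
   in the first variable, zero beyond row [n - 1]. *)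
Definition unroll m n (F : 'I_m * 'I_n -> nat) (i j : nat) : nat :=
  \sum_(u : 'I_m * 'I_n | (u.1 == i %% m :> nat) && (u.2 == j :> nat)) F u.

(** * Closed neighbourhoods of the cylinder in unrolled coordinates *)

Section Unroll.

Variables (m n : nat) (F : 'I_m * 'I_n -> nat).

Lemma unroll_period i j : unroll F (i + m) j = unroll F i j.
Proof. by rewrite /unroll modnDr. Qed.

Lemma unroll_out i j : n <= j -> unroll F i j = 0.
Proof.
by move=> nj; apply: big_pred0 => -[a b] /=; have := ltn_ord b; lia.
Qed.

Lemma unroll_in i j (a : 'I_m) (b : 'I_n) :
  a = i %% m :> nat -> b = j :> nat -> unroll F i j = F (a, b).
Proof.
by rewrite /unroll => <- <-; rewrite (big_pred1 (a, b)) // => -[c d] /=.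
Qed.

Hypothesis m_ge3 : 3 <= m.

Lemma modnS_lt x : x < m -> x.+1 %% m = if x.+1 == m then 0 else x.+1.
Proof.
by case: eqP => [<-|] *; [rewrite modnn | rewrite modn_small //; lia].
Qed.

(** Centring at column i + 1 avoids predecessors modulo m. The indicators never overlap, since three
    consecutive columns are distinct when m is at least 3. *)
Lemma closed_nbhd_cylinder i (v u : 'I_m * 'I_n) : v.1 = i.+1 %% m :> nat ->
  (u \in closed_nbhd (cart_prod (@cycle_graph m) (@path_graph n)) v : nat) =
    ((u.1 == i %% m :> nat) && (u.2 == v.2 :> nat))
  + ((u.1 == i.+1 %% m :> nat) && (u.2 == v.2 :> nat))
  + ((u.1 == i.+2 %% m :> nat) && (u.2 == v.2 :> nat))
  + ((u.1 == i.+1 %% m :> nat) && (u.2 == v.2.+1 :> nat))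
  + ((u.1 == i.+1 %% m :> nat) && (u.2.+1 == v.2 :> nat)).
Proof.
case: v u => [a b] [c d] /= aE.
have m_gt0 : 0 < m by lia.
rewrite !inE /cart_prod /cycle_graph /path_graph /= -!pair_eqE /pair_eq /= -!val_eqE /=.
have stepE x : x.+1 %% m = (x %% m).+1 %% m by rewrite -addn1 -modnDml addn1.
rewrite (stepE i.+1) -aE; move: aE; rewrite (stepE i).
have := ltn_ord a; have := ltn_ord c; have := ltn_pmod i m_gt0.
set p := i %% m; move=> pm cm am; rewrite !modnS_lt //; clearbody p.
move: (nat_of_ord a) (nat_of_ord b) (nat_of_ord c) (nat_of_ord d) cm am.
clear -m_ge3 pm => {}a {}b {}c {}d cm am aE.
have -> : (a == (if c.+1 == m then 0 else c.+1)) = (c == p).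
  by rewrite {}aE; case: (p.+1 =P m) => ?; case: (c.+1 =P m) => ?; lia.
set q := if a.+1 == m then 0 else a.+1.
have [pa qp aq] : [/\ p != a, p != q & a != q].
  by rewrite /q aE; case: (p.+1 =P m) => ?; case: (_ =P m) => ?; split; lia.
have [->|db] := eqVneq d b; last first.
  by rewrite !andbF /= (eq_sym a); case: eqP; lia.
rewrite !(gtn_eqF (ltnSn b)) !(ltn_eqF (ltnSn b)) !andbF !andbT /=.
have [->|cp] := eqVneq c p; first by rewrite (negbTE pa) (negbTE qp).
have [->|ca] := eqVneq c a; first by rewrite (negbTE aq).
by rewrite orbF !addn0.
Qed.

Lemma sum_closed_nbhd_cylinder i (v : 'I_m * 'I_n) : v.1 = i.+1 %% m :> nat ->
  \sum_(u in closed_nbhd (cart_prod (@cycle_graph m) (@path_graph n)) v) F u =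
    unroll F i v.2 + unroll F i.+1 v.2 + unroll F i.+2 v.2
  + unroll F i.+1 v.2.+1 + (if v.2 : nat is j.+1 then unroll F i.+1 j else 0).
Proof.
(* Full sums with 0/1 weights let the indicator identity be applied termwise. *)
move=> vE; pose s (P : pred ('I_m * 'I_n)) := \sum_u P u * F u.
have sE P : \sum_(u | P u) F u = s P.
  by rewrite /s big_mkcond; apply: eq_bigr => u _; case: (P u); rewrite ?mul1n.
have -> : (if v.2 : nat is j.+1 then unroll F i.+1 j else 0) =
    s (fun u => (u.1 == i.+1 %% m :> nat) && (u.2.+1 == v.2 :> nat)).
  case: (v.2 : nat) => [|j]; last by rewrite /unroll sE.
  by rewrite /s big1 // => u _; rewrite andbF.
rewrite /unroll !sE /s -!big_split; apply: eq_bigr => u _.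
by rewrite /= (closed_nbhd_cylinder _ vE) !mulnDl.
Qed.

End Unroll.

(** For the constant function 1 the five-term formula computes 1 + deg v, and its three horizontal
    terms already give 3. *)
Lemma cylinder_degree m n (m_ge3 : 3 <= m) (v : 'I_m * 'I_n) :
  1 < #|open_nbhd (cart_prod (@cycle_graph m) (@path_graph n)) v|.
Proof.
set G := cart_prod _ _; have irrG : irreflexive G := cart_prod_cycle_path_irrefl m_ge3.
have := sum_closed_nbhd irrG (fun=> 1) v.
have m_gt0 : 0 < m by lia.
have vE : v.1 = (v.1 + m.-1).+1 %% m :> nat.
  by rewrite -addnS prednK // modnDr modn_small.
have unroll1 i : unroll (fun _ : 'I_m * 'I_n => 1) i v.2 = 1.
  by rewrite (@unroll_in _ _ _ _ _ (Ordinal (ltn_pmod i m_gt0)) v.2).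
by rewrite (sum_closed_nbhd_cylinder _ m_ge3 vE) !unroll1 sum1_card; lia.
Qed.

(* Starting from a point of [h], the next one is exactly [d] further, so
   [i + m] can only be reached if [d] divides [m]. *)
Lemma dvdn_spaced_period (h : pred nat) (d m i : nat) :
  0 < d -> (forall i, h i -> h (i + d)) ->
  (forall i r, h i -> 0 < r < d -> ~~ h (i + r)) ->
  (forall i, h (i + m) = h i) -> h i -> d %| m.
Proof.
move=> d_gt0 hd gap hm hi.
have hq q : h (i + q * d).
  by elim: q => [|q]; rewrite ?addn0 // mulSnr addnA; apply: hd.
have := hm i; rewrite {1}(divn_eq m d) addnA hi => hr.
have [//|r_gt0] := posnP (m %% d).
  by rewrite /dvdn => ->.
by have := gap _ (m %% d) (hq (m %/ d)); rewrite r_gt0 ltn_pmod // hr => /(_ isT).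
Qed.

(** * Perfect periodic patterns on a strip of height n *)

Section PerfectStrip.

Variables (m n : nat) (g : nat -> nat -> nat).
Hypothesis m_ge3 : 3 <= m.
Hypothesis n_gt0 : 0 < n.
Hypothesis g_period : forall i j, g (i + m) j = g i j.
Hypothesis g_out : forall i j, n <= j -> g i j = 0.
Hypothesis g_perfect : forall i j, j < n ->
  g i j + g i.+1 j + g i.+2 j + g i.+1 j.+1
    + (if j is j'.+1 then g i.+1 j' else 0) = 1.

Let row0 i : g i 0 + g i.+1 0 + g i.+2 0 + g i.+1 1 = 1.
Proof. by rewrite -[RHS](@g_perfect i _ n_gt0) addn0. Qed.

Let row1 (n_gt1 : 1 < n) i :
  g i 1 + g i.+1 1 + g i.+2 1 + g i.+1 2 + g i.+1 0 = 1.
Proof. exact: (@g_perfect i _ n_gt1). Qed.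

Let row2 (n_gt2 : 2 < n) i :
  g i 2 + g i.+1 2 + g i.+2 2 + g i.+1 3 + g i.+1 1 = 1.
Proof. exact: (@g_perfect i _ n_gt2). Qed.

(** Including the case where row 2 is absent lets the knight-move lemmas cover n = 2. *)
Lemma row2_adjacent i : g i 2 + g i.+1 2 <= 1.
Proof.
have [n2|n2] := leqP n 2; first by rewrite !g_out.
by have := row2 n2 i; lia.
Qed.

(** If columns 0 to 3 of row 0 were empty, (1, 0) and (2, 0) would need the adjacent vertices (1, 1)
    and (2, 1), or stay undominated when n = 1. *)
Lemma row0_inhabited : exists i, g i 0 = 1.
Proof.
suff [i gi] : exists i, 0 < g i 0 by exists i; have := row0 i; lia.
have [?|?] := posnP (g 0 0); last by exists 0.
have [?|?] := posnP (g 1 0); last by exists 1.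
have [?|?] := posnP (g 2 0); last by exists 2.
have [?|?] := posnP (g 3 0); last by exists 3.
have := row0 0; have := row0 1.
have [n1|n1] := leqP n 1; first by rewrite !(g_out _ n1); lia.
by have := row1 n1 1; lia.
Qed.

(* Otherwise (i + 3, 0) would be in the set, and together with (i, 0) it would
   force the adjacent vertices (i + 1, 2) and (i + 2, 2) into the set. *)
Lemma knight_right i : 1 < n -> g i 0 = 1 -> g i.+2 1 = 1.
Proof.
move=> n1; rewrite -g_period -[g i.+2 1]g_period !addSn.
(* Shifting by one period makes room for the column to the left. *)
have -> : i + m = (i + m).-1.+1 by lia.
move: (i + m).-1 => {}i gi; have := row2_adjacent i.+2.
have := row0 i; have := row0 i.+1; have := row0 i.+2; have := row0 i.+3.
have := row1 n1 i.+1; have := row1 n1 i.+2; lia.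
Qed.

(** Mirror image of [knight_right], from the same local equations. *)
Lemma knight_left i : 1 < n -> g i.+4 0 = 1 -> g i.+2 1 = 1.
Proof.
move=> n1 gi; have := row2_adjacent i.+2.
have := row0 i; have := row0 i.+1; have := row0 i.+2; have := row0 i.+3.
have := row1 n1 i.+1; have := row1 n1 i.+2; lia.
Qed.

(* With (i, 0) and (i + 2, 1), (i - 2, 1), the vertex (i, 2) can only be
   dominated by (i, 3), which leaves (i + 1, 2) undominated. *)
Lemma perfect_strip_height : n <= 2.
Proof.
rewrite leqNgt; apply/negP => n2; have n1 := ltnW n2.
have [i gi] := row0_inhabited.
(* One period may be only 3; two make the subtraction of 4 exact. *)
have {gi} : g (i + m + m) 0 = 1 by rewrite !g_period.
have -> : i + m + m = (i + m + m - 4).+4 by lia.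
move: (i + m + m - 4) => {}i gi.
have := knight_left n1 gi; have := knight_right n1 gi.
have := row0 i.+3; have := row1 n1 i.+2; have := row1 n1 i.+3.
have := row1 n1 i.+4; have := row1 n1 i.+4.+1.
have := row2 n2 i.+3; have := row2 n2 i.+4.
have : g i.+4 3 + g i.+4.+1 3 <= 1.
  have [n3|n3] := leqP n 3; first by rewrite !g_out.
  by have := @g_perfect i.+4 _ n3; lia.
lia.
Qed.

Lemma perfect_strip_1 : n = 1 -> 3 %| m.
Proof.
move=> n1; have [i gi] := row0_inhabited.
have row j : g j 0 + g j.+1 0 + g j.+2 0 = 1.
  by rewrite -[RHS](row0 j) (@g_out j.+1 1) ?n1 // addn0.
apply: (@dvdn_spaced_period (fun j => g j 0 == 1) _ _ i) => //.
- by move=> j; have := row j; have := row j.+1; rewrite addn3; lia.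
- move=> j [|[|[|r]]] // gj _; have := row j; rewrite ?addn1 ?addn2; lia.
- by move=> j /=; rewrite g_period.
- by rewrite gi.
Qed.

(** Given (j, 0) and (j + 2, 1), the vertices (j + 1, 0) and (j + 2, 0) are already dominated, so
    row 0 is empty at j + 1, j + 2 and j + 3. Then only (j + 4, 0) can dominate (j + 3, 0). *)
Lemma perfect_strip_2 : n = 2 -> 4 %| m.
Proof.
move=> n2; have n1 : 1 < n by rewrite n2.
have [i gi] := row0_inhabited.
have row j : g j 1 + g j.+1 1 + g j.+2 1 + g j.+1 0 = 1.
  by rewrite -[RHS](row1 n1 j) (@g_out j.+1 2) ?n2 // addn0.
apply: (@dvdn_spaced_period (fun j => g j 0 == 1) _ _ i) => //.
- move=> j /eqP gj; have := knight_right n1 gj; rewrite addn4.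
  have := row j; have := row j.+1; have := row j.+2; have := row j.+3.
  have := row0 j; have := row0 j.+1; have := row0 j.+2; have := row0 j.+3; lia.
- move=> j [|[|[|[|r]]]] // /eqP gj _; have := knight_right n1 gj;
    have := row0 j; have := row0 j.+1; have := row0 j.+2; have := row j.+1;
    rewrite ?addn1 ?addn2 ?addn3; lia.
- by move=> j /=; rewrite g_period.
- by rewrite gi.
Qed.

End PerfectStrip.

(** * Efficient dominating sets of the cylinder *)

Section Cylinder.

Variables (m n : nat).
Hypothesis m_ge3 : 3 <= m.

Let G := cart_prod (@cycle_graph m) (@path_graph n).

Lemma efficient_cylinder_size (D : {set 'I_m * 'I_n}) : 0 < n ->
  efficient_dominating_set G D -> n = 1 /\ 3 %| m \/ n = 2 /\ 4 %| m.
Proof.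
move=> n_gt0 /(efficient_sumP (@cart_prod_cycle_path_sym m n)) effD.
pose g := unroll (fun u => u \in D : nat).
have g_period i j : g (i + m) j = g i j := unroll_period _ i j.
have g_out i j : n <= j -> g i j = 0 := @unroll_out _ _ _ i j.
have g_perfect i j : j < n ->
    g i j + g i.+1 j + g i.+2 j + g i.+1 j.+1
      + (if j is j'.+1 then g i.+1 j' else 0) = 1.
  move=> jn; have m_gt0 : 0 < m by lia.
  pose v := (Ordinal (ltn_pmod i.+1 m_gt0), Ordinal jn).
  by rewrite -(effD v) (@sum_closed_nbhd_cylinder _ _ _ m_ge3 i).
have := perfect_strip_height m_ge3 n_gt0 g_period g_out g_perfect.
rewrite leq_eqVlt ltnS => /orP[/eqP n2|n1]; [right|left].
  by split=> //; apply: (perfect_strip_2 m_ge3 n_gt0 g_period g_out g_perfect).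
have {}n1 : n = 1 by lia.
by split=> //; apply: (perfect_strip_1 m_ge3 n_gt0 g_period g_out g_perfect).
Qed.

(** Reduces the check of an explicit set to arithmetic on residues. *)
Lemma efficient_of_pattern (P : nat -> nat -> bool) :
  (forall i j, P (i %% m) j = P i j) ->
  (forall i j, n <= j -> P i j = false) ->
  (forall i j, j < n -> P i j + P i.+1 j + P i.+2 j + P i.+1 j.+1
      + (if j is j'.+1 then P i.+1 j' : nat else 0) = 1) ->
  efficient_dominating_set G [set u : 'I_m * 'I_n | P u.1 u.2].
Proof.
move=> Pmod Pout Pperf.
apply/(efficient_sumP (@cart_prod_cycle_path_sym m n)) => v.
have m_gt0 : 0 < m by lia.
have unrollP i j :
    unroll (fun u => u \in [set u : 'I_m * 'I_n | P u.1 u.2] : nat) i j = P i j.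
  have [jn|jn] := leqP n j; first by rewrite unroll_out // Pout.
  rewrite (@unroll_in _ _ _ _ _ (Ordinal (ltn_pmod i m_gt0)) (Ordinal jn)) //.
  by rewrite inE /= Pmod.
have vE : v.1 = (v.1 + m.-1).+1 %% m :> nat.
  by rewrite -addnS prednK // modnDr modn_small.
rewrite (sum_closed_nbhd_cylinder (fun u => u \in _ : nat) m_ge3 vE) !unrollP.
rewrite -[RHS](Pperf (v.1 + m.-1) _ (ltn_ord v.2)).
by case: (nat_of_ord v.2) => // j; rewrite unrollP.
Qed.

Lemma cylinder_size_efficient : n = 1 /\ 3 %| m \/ n = 2 /\ 4 %| m ->
  exists D, efficient_dominating_set G D.
Proof.
move=> [[n1 m3]|[n2 m4]].
  exists [set u : 'I_m * 'I_n | (u.1 %% 3 == 0) && (u.2 < 1)].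
  apply: (@efficient_of_pattern (fun i j => (i %% 3 == 0) && (j < 1))).
  - by move=> i j; rewrite modn_dvdm.
  - by move=> i j; rewrite n1; lia.
  - by move=> i [|j]; rewrite n1 //; lia.
(* Columns 0 mod 4 in row 0 and 2 mod 4 in row 1: the pattern forced by the knight moves. *)
exists [set u : 'I_m * 'I_n | (u.1 %% 4 == u.2.*2) && (u.2 < 2)].
apply: (@efficient_of_pattern (fun i j => (i %% 4 == j.*2) && (j < 2))).
- by move=> i j; rewrite modn_dvdm.
- by move=> i j; rewrite n2; lia.
- by move=> i [|[|j]]; rewrite n2 //; lia.
Qed.

End Cylinder.

Theorem theorem2 (m n k : nat) (hm : 3 <= m) (hn : 1 <= n) (hk : 1 <= k) :
  let G := cart_prod (@cycle_graph m) (@path_graph n) in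
  let S1 := exists D : {set 'I_m * 'I_n}, efficient_dominating_set G D in
  let S2 := exists f : {ffun 'I_m * 'I_n -> 'I_k.+2},
      roman_dominating G f /\
      forall v : 'I_m * 'I_n, \sum_(u in closed_nbhd G v) f u = k + 1 in
  let S3 := (n = 1 /\ m = 0 %[mod 3]) \/ (n = 2 /\ m = 0 %[mod 4]) in
  (S1 <-> S2) /\ (S2 <-> S3).
Proof.
move=> G S1 S2 S3.
have S12 : S1 -> S2.
  by move=> [D]; apply: roman_of_efficient; apply: cart_prod_cycle_path_sym.
have S21 : S2 -> S1.
  move=> [f [romf sumf]]; exists [set v | f v == ord_max].
  apply: (@efficient_of_roman _ G) => //; first exact: cart_prod_cycle_path_sym.
    exact: cart_prod_cycle_path_irrefl.
  exact: cylinder_degree.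
have mod0 d : d %| m <-> m = 0 %[mod d].
  by rewrite mod0n /dvdn; split=> /eqP.
have S13 : S1 <-> S3.
  rewrite /S3 -!mod0; split; last exact: cylinder_size_efficient.
  by move=> [D]; apply: efficient_cylinder_size.
by split; [split | rewrite -S13; split].
Qed.
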